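(* Let $V$ be a finite set, let $X,Y$ be disjoint subsets of $V$, and let $N$ be a Lagrangian chain-group on $V$ to $K$. The following are equivalent: (i) $\lambda_N(Z)\ge k$ for all sets $Z$ with $X\subseteq Z\subseteq V\setminus Y$; (ii) there is a minor $M$ of $N$ on $X\cup Y$ such that $\lambda_M(X)\ge k$. In other words, \[\min\{\lambda_N(Z): X\subseteq Z\subseteq V\setminus Y\}=\max\{\lambda_{N\setminus U/W}(X): U\cup W=V\setminus(X\cup Y),\ U\cap W=\emptyset\}.\]
   Context: $\mathbb{F}$ is a field, $K=\mathbb{F}^2$ with bilinear form $\langle\,,\,\rangle_K$ either $b^+(\binom ab,\binom cd)=ad+bc$ or $b^-(\binom ab,\binom cd)=ad-bc$. Chains on $V$ to $K$ are maps $V\to K$, forming $K^V$ with $\langle f,g\rangle=\sum_x\langle f(x),g(x)\rangle_K$. A chain-group is a subspace of $K^V$; it is Lagrangian if $\langle f,g\rangle=0$ for all $f,g\in N$ and $\dim N=|V|$. For $T\subseteq V$: $f\cdot T$ is restriction; $N\times T=\{f\cdot T:f\in N, f(x)=0\ \forall x\notin T\}$; $N\setminus T=\{f\cdot(V\setminus T): f\in N,\ \langle f(x),\binom10\rangle_K=0\ \forall x\in T\}$; $N/T=\{f\cdot(V\setminus T): f\in N,\ \langle f(x),\binom01\rangle_K=0\ \forall x\in T\}$. A minor of $N$ is $N/X'\setminus Y'$ for disjoint $X',Y'$. The connectivity function of a chain-group $N$ on $V$ is $\lambda_N(U)=\frac12(\dim N-\dim(N\times(V\setminus U))-\dim(N\times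 U))$. *)

(* Defs.v *)
From HB Require Import structures.
From mathcomp Require Import all_boot all_order all_algebra.
Set Implicit Arguments.
Unset Strict Implicit.
Unset Printing Implicit Defensive.
Import Order.TTheory GRing.Theory Num.Theory.
Local Open Scope ring_scope.

Definition vec2 (F : fieldType) (a b : F) : 'cV[F]_2 :=
  \col_(i < 2) (if i == ord0 then a else b).

Definition bplus (F : fieldType) (u v : 'cV[F]_2) : F :=
  u ord0 ord0 * v ord_max ord0 + u ord_max ord0 * v ord0 ord0.

Definition bminus (F : fieldType) (u v : 'cV[F]_2) : F :=
  u ord0 ord0 * v ord_max ord0 - u ord_max ord0 * v ord0 ord0.

(* The two admissible forms on K = F^2; [F^o] is F seen as a vector space. *)
Definition formK (F : fieldType) (skew : bool) (u v : 'cV[F]_2) : F^o :=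
  if skew then bminus u v else bplus u v.

(* Ground sets are subsets S of an ambient finite type E, so that a chain-group
   and all its minors live over the same E, each with its own space K^S. *)
Definition chain (F : fieldType) (E : finType) (S : {set E}) :=
  {ffun {x : E | x \in S} -> 'cV[F]_2}.

Notation chain_group F S := {vspace (chain F S)}.

Definition form_chain (F : fieldType) (E : finType) (skew : bool)
    (S : {set E}) (f g : chain F S) : F :=
  \sum_x formK skew (f x) (g x).

Definition lagrangian (F : fieldType) (E : finType) (skew : bool)
    (S : {set E}) (N : chain_group F S) : Prop :=
  (forall f g : chain F S, f \in N -> g \in N -> form_chain skew f g = 0)
  /\ \dim N = #|S|.

(* The restriction f . T, meant for T \subset S; a point of T outside S gets
   the value 0. *)
Definition restrict (F : fieldType) (E : finType) (S T : {set E})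
    (f : chain F S) : chain F T :=
  [ffun x : {x : E | x \in T} =>
     if insub (val x) is Some y then f y else 0 : 'cV[F]_2].

(* The maps passed to [linfun] below are linear; the sets of chains thus
   obtained are given by the lemmas at the end of the file. *)
Definition cg_times (F : fieldType) (E : finType) (S : {set E})
    (N : chain_group F S) (T : {set E}) : chain_group F T :=
  (linfun (@restrict F E S T) @:
     (N :&: \bigcap_(x : {x : E | x \in S} | val x \notin T)
              lker (linfun (fun f : chain F S => f x))))%VS.

Definition cg_minor_by (F : fieldType) (E : finType) (skew : bool)
    (e : 'cV[F]_2) (S : {set E}) (N : chain_group F S) (T : {set E}) :
    chain_group F (S :\: T) :=
  (linfun (@restrict F E S (S :\: T)) @:
     (N :&: \bigcap_(x : {x : E | x \in S} | val x \in T)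
              lker (linfun (fun f : chain F S => formK skew (f x) e))))%VS.

Definition cg_delete (F : fieldType) (E : finType) (skew : bool)
    (S : {set E}) (N : chain_group F S) (T : {set E}) :=
  cg_minor_by skew (vec2 1 0) N T.

Definition cg_contract (F : fieldType) (E : finType) (skew : bool)
    (S : {set E}) (N : chain_group F S) (T : {set E}) :=
  cg_minor_by skew (vec2 0 1) N T.

Inductive is_minor (F : fieldType) (E : finType) (skew : bool)
    (S : {set E}) (N : chain_group F S) :
    forall S' : {set E}, chain_group F S' -> Prop :=
| IsMinor (X' Y' : {set E}) of X' \subset S & Y' \subset S
    & [disjoint X' & Y'] :
    is_minor skew N (cg_delete skew (cg_contract skew N X') Y').

(* Rational-valued: the factor 1/2 is exact even for a chain-group that is not
   Lagrangian. *)
Definition connectivity (F : fieldType) (E : finType) (S : {set E})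
    (N : chain_group F S) (U : {set E}) : rat :=
  ((\dim N)%:R - (\dim (cg_times N (S :\: U)))%:R - (\dim (cg_times N U))%:R)
  / 2%:R.

Section Membership.
Variables (F : fieldType) (E : finType) (skew : bool).

Lemma vec2E (a b : F) :
  (vec2 a b ord0 ord0 = a) * (vec2 a b ord_max ord0 = b).
Proof. by rewrite !mxE. Qed.

Lemma restrictE (S T : {set E}) (f : chain F S) (x : E)
    (xS : x \in S) (xT : x \in T) :
  restrict T f (exist _ x xT) = f (exist _ x xS).
Proof.
rewrite ffunE /=; case: insubP => [y _ yx|]; last by rewrite xS.
by congr (f _); apply: val_inj.
Qed.

Lemma restrict_linear (S T : {set E}) : linear (@restrict F E S T).
Proof.
move=> a f g; apply/ffunP => x; rewrite !ffunE.
by case: insub => [y|]; rewrite ?ffunE // scaler0 addr0.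
Qed.

Lemma eval_linear (S : {set E}) (x : {x : E | x \in S}) :
  linear (fun f : chain F S => f x).
Proof. by move=> a f g; rewrite !ffunE. Qed.

Lemma form_eval_linear (S : {set E}) (x : {x : E | x \in S}) (e : 'cV[F]_2) :
  linear (fun f : chain F S => formK skew (f x) e).
Proof.
move=> a f g; rewrite !ffunE /formK /bplus /bminus /GRing.scale /= !mxE.
case: skew; rewrite !mulrDl ?mulrBr ?mulrDr ?opprD -!mulrA.
  by rewrite -!addrA; congr (_ + _); rewrite addrCA.
by rewrite -!addrA; congr (_ + _); rewrite addrCA.
Qed.

Lemma linfunE (aT rT : vectType F) (f : aT -> rT) : linear f -> linfun f =1 f.
Proof.
move=> lf; pose m := GRing.isLinear.Build _ _ _ _ f lf.
pose g : {linear aT -> rT} := HB.pack f m.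
exact: (lfunE g).
Qed.

Lemma mem_cg_times (S : {set E}) (N : chain_group F S) (T : {set E})
    (g : chain F T) :
  g \in cg_times N T <->
  exists f : chain F S,
    [/\ f \in N,
        forall x : {x : E | x \in S}, val x \notin T -> f x = 0
      & g = restrict T f].
Proof.
split=> [/memv_imgP [f fN ->]|[f [fN f0 ->]]].
  exists f; move: fN; rewrite memv_cap => /andP[fN /subv_bigcapP fT].
  split=> // [x xT|]; last by rewrite linfunE //; exact: restrict_linear.
  have := fT x xT; rewrite -memvE memv_ker linfunE; last exact: eval_linear.
  by move/eqP.
apply/memv_imgP; exists f; last by rewrite linfunE //; exact: restrict_linear.
rewrite memv_cap fN /=; apply/subv_bigcapP => x xT.
rewrite -memvE memv_ker linfunE; last exact: eval_linear.
by rewrite f0.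
Qed.

Lemma mem_cg_minor_by (e : 'cV[F]_2) (S : {set E}) (N : chain_group F S)
    (T : {set E}) (g : chain F (S :\: T)) :
  g \in cg_minor_by skew e N T <->
  exists f : chain F S,
    [/\ f \in N,
        forall x : {x : E | x \in S}, val x \in T -> formK skew (f x) e = 0
      & g = restrict (S :\: T) f].
Proof.
split=> [/memv_imgP [f fN ->]|[f [fN f0 ->]]].
  exists f; move: fN; rewrite memv_cap => /andP[fN /subv_bigcapP fT].
  split=> // [x xT|]; last by rewrite linfunE //; exact: restrict_linear.
  have := fT x xT; rewrite -memvE memv_ker linfunE; last exact: form_eval_linear.
  by move/eqP.
apply/memv_imgP; exists f; last by rewrite linfunE //; exact: restrict_linear.
rewrite memv_cap fN /=; apply/subv_bigcapP => x xT.
rewrite -memvE memv_ker linfunE; last exact: form_eval_linear.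
by rewrite f0.
Qed.

End Membership.

(* Main.v *)
(** For a Lagrangian chain-group [L] the restriction of [L] to [U] is orthogonal
    to [L x U]; counting dimensions for [U] and its complement gives
    lambda(U) = |U| - dim (L x U), an integer.  Hence lambda does not increase
    under minors, and for a point [v] and sets [X1], [Y1] avoiding it
      lambda_{L\v}(X1) + lambda_{L/v}(Y1)
        >= lambda_L(X1 :&: Y1) + lambda_L(v |: (X1 :|: Y1)) - 1.
    If neither L\v nor L/v kept the bound [k], two violating sets X1, Y1 would
    contradict this inequality, so the points outside X and Y can be removed one
    at a time.  To avoid transport between the spaces K^S, all chains are
    extended by zero to the ambient finite type [E]. *)

Require Import Defs.
From HB Require Import structures.
From mathcomp Require Import all_boot all_order all_algebra.
From mathcomp Require Import zify.
Set Implicit Arguments.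
Unset Strict Implicit.
Unset Printing Implicit Defensive.
Import Order.TTheory GRing.Theory Num.Theory.
Local Open Scope ring_scope.

(* The two elaborations of [\dim] (with and without [reverse_coercion]) must be
   identified before [lia] can treat them as one atom. *)
Local Ltac dim_lia := unfold reverse_coercion in *; lia.

(** * Ambient model: chains on [E], their minors and connectivity *)

Section Ambient.
Variables (F : fieldType) (E : finType) (skew : bool).

Local Notation K := 'cV[F]_2.
Local Notation achain := {ffun E -> K}.
Implicit Types (S T U Z A B : {set E}) (f g : achain) (L : {vspace achain}).

(** Plays the role of restriction to the complement of [T] while the ambient space stays fixed. *)
Definition erase T (f : achain) : achain :=
  [ffun x => if x \in T then 0 else f x].

(** Pairing with (1,0) reads off the second coordinate up to sign, pairing with (0,1) the first. So
    [true] encodes deletion and [false] contraction. *)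
Definition axis (b : bool) : 'I_2 := if b then ord_max else ord0.

Definition aform (f g : achain) : F := \sum_x formK skew (f x) (g x).

Definition times L T : {vspace achain} := (L :&: lker (linfun (erase T)))%VS.

(* On the points of [A] the condition is orthogonality to (1,0), i.e. deletion;
   on the points of [T :\: A] it is orthogonality to (0,1), i.e. contraction. *)
Definition minor A T L : {vspace achain} :=
  (linfun (erase T) @:
     (L :&: \bigcap_(x in T)
        lker (linfun (fun f : achain => f x (axis (x \in A)) ord0 : F^o))))%VS.

(** The support condition stands in for membership in K^S. *)
Definition alagrangian S L : Prop :=
  [/\ forall f x, f \in L -> x \notin S -> f x = 0,
      forall f g, f \in L -> g \in L -> aform f g = 0
    & \dim L = #|S|].

(* The connectivity function of a Lagrangian chain-group ([connectivity_lam]);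
   the subtraction is then never truncated ([times_dim_le]). *)
Definition lam L U : nat := (#|U| - \dim (times L U))%N.

(** * Coordinates and the two forms on K *)

Lemma erase_linear T : linear (erase T).
Proof.
by move=> a f g; apply/ffunP => x; rewrite !ffunE; case: ifP; rewrite ?scaler0 ?addr0.
Qed.

Lemma coord_linear x (i : 'I_2) :
  linear (fun f : achain => f x i ord0 : F^o).
Proof. by move=> a f g; rewrite !ffunE !mxE. Qed.

Lemma coords_eq0 (u : K) b :
  u (axis b) ord0 = 0 -> u (axis (~~ b)) ord0 = 0 -> u = 0.
Proof.
move=> u1 u2; apply/colP => i; rewrite mxE.
have : i = axis b \/ i = axis (~~ b).
  by case: b {u1 u2} i => [] [[|[|//]] h]; [right|left|left|right]; apply: val_inj.
by case=> ->.
Qed.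

Lemma formK0l (u : K) : formK skew 0 u = 0.
Proof. by rewrite /formK /bminus /bplus !mxE !mul0r subr0 addr0; case: skew. Qed.

Lemma formK0r (u : K) : formK skew u 0 = 0.
Proof. by rewrite /formK /bminus /bplus !mxE !mulr0 subr0 addr0; case: skew. Qed.

(** Both forms multiply only unlike coordinates, so each coordinate axis is an isotropic line. *)
Lemma formK_isotropic (u w : K) b :
  u (axis b) ord0 = 0 -> w (axis b) ord0 = 0 -> formK skew u w = 0.
Proof.
rewrite /formK /bminus /bplus /axis.
by case: b => -> ->; rewrite !(mul0r, mulr0) subr0 addr0; case: skew.
Qed.

(** By nondegeneracy, the orthogonal complement of a nonzero vector on a coordinate axis is a line,
    namely that axis. *)
Lemma formK_orthogonal (u w : K) b :
  w (axis b) ord0 = 0 -> w != 0 -> formK skew u w = 0 -> u (axis b) ord0 = 0.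
Proof.
move=> wb w0 /eqP uw; apply/eqP; apply: contraNT w0 => ub.
apply/eqP; apply: (coords_eq0 wb); apply/eqP.
move: uw ub wb; rewrite /formK /bminus /bplus /axis.
by case: b => /= uw ub wb; move: uw; rewrite wb mulr0 ?add0r ?addr0 ?sub0r ?subr0;
  case: skew; rewrite ?oppr_eq0 mulf_eq0 (negbTE ub).
Qed.

Lemma formK_axis (u : K) b :
  (formK skew u (if b then vec2 1 0 else vec2 0 1) == 0)
    = (u (axis b) ord0 == 0).
Proof.
rewrite /formK /bminus /bplus; case: b; rewrite !vec2E !mulr0 !mulr1.
  by rewrite !add0r; case: skew; rewrite ?oppr_eq0.
by rewrite addr0 subr0; case: skew.
Qed.

Lemma mem_times L T f :
  f \in times L T <-> f \in L /\ forall x, x \notin T -> f x = 0.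
Proof.
rewrite memv_cap memv_ker linfunE; last exact: erase_linear.
split=> [/andP[-> /eqP e]|[-> f0]] /=.
  split=> // x xT; move/ffunP/(_ x): e.
  by rewrite !ffunE (negbTE xT).
apply/eqP/ffunP => x; rewrite !ffunE; case: ifPn => // /f0; exact.
Qed.

Lemma mem_minor A T L g :
  g \in minor A T L <->
  exists f, [/\ f \in L, forall x, x \in T -> f x (axis (x \in A)) ord0 = 0
              & g = erase T f].
Proof.
split=> [/memv_imgP [f fN ->]|[f [fN f0 ->]]].
  exists f; move: fN; rewrite memv_cap => /andP[fN /subv_bigcapP fT].
  split=> // [x xT|]; last by rewrite linfunE //; exact: erase_linear.
  have := fT x xT; rewrite -memvE memv_ker linfunE; last exact: coord_linear.
  by move/eqP.
apply/memv_imgP; exists f; last by rewrite linfunE //; exact: erase_linear.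
rewrite memv_cap fN /=; apply/subv_bigcapP => x xT.
rewrite -memvE memv_ker linfunE; last exact: coord_linear.
by rewrite f0.
Qed.

(** * Orthogonality, dimension counts and symmetry of connectivity *)

(** Written in coordinates, bases of [L] and [M] give two matrices of full row rank with [2 * #|U|]
    columns. Once the form is absorbed into the second one, the first times its transpose is zero,
    which bounds the sum of the ranks. *)
Lemma dim_orthogonal U (L M : {vspace achain}) :
    (forall f x, f \in L -> x \notin U -> f x = 0) ->
    (forall f x, f \in M -> x \notin U -> f x = 0) ->
    (forall f g, f \in L -> g \in M -> aform f g = 0) ->
  (\dim L + \dim M <= 2 * #|U|)%N.
Proof.
move=> L0 M0 LM.
pose D := setX U [set: 'I_2].
pose mx (W : {vspace achain}) (s : achain -> E -> 'I_2 -> F) :=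
  \matrix_(i < \dim W, j < #|D|)
    s (vbasis W)`_i (enum_val j).1 (enum_val j).2.
(* Linear coordinates over [U] that vanish together only at 0 in [W] make the rows of the matrix
   independent. *)
have mx_rank (W : {vspace achain}) (s : achain -> E -> 'I_2 -> F)
    (sl : forall x i, linear (fun f => s f x i : F^o)) :
    (forall f, f \in W -> (forall x i, x \in U -> s f x i = 0) -> f = 0) ->
    \rank (mx W s) = \dim W.
  move=> s0; apply/eqP; rewrite -[_ == _]/(row_free _); apply/inj_row_free => u uW.
  have := basis_free (vbasisP W) => /freeP fr.
  have e : \sum_i u 0 i *: (vbasis W)`_i = 0.
    apply: s0; first (apply: memv_suml => i _;
      by rewrite memvZ // vbasis_mem // mem_nth // size_tuple).
    move=> x i xU; have xD : (x, i) \in D by rewrite !inE xU.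
    move/rowP/(_ (enum_rank_in xD (x, i))): uW; rewrite !mxE.
    under eq_bigr do rewrite mxE enum_rankK_in //=.
    move=> <-.
    pose m := GRing.isLinear.Build _ _ _ _ _ (sl x i).
    pose h : {linear achain -> F^o} := HB.pack (fun f => s f x i : F^o) m.
    rewrite -[LHS]/(h _) linear_sum; apply: eq_bigr => j _.
    by rewrite linearZ.
  by apply/rowP => i; rewrite mxE (fr _ e).
(* [formK skew (f x) (g x) = \sum_i f x i * dual g x i] *)
pose dual (g : achain) x (i : 'I_2) : F :=
  if i == ord0 then g x ord_max ord0
  else (if skew then - g x ord0 ord0 else g x ord0 ord0).
have LE : \rank (mx L (fun f x i => f x i ord0)) = \dim L.
  apply: mx_rank => [x i|f fL f0]; first exact: coord_linear.
  apply/ffunP => x; rewrite ffunE; have [xU|xU] := boolP (x \in U); last exact: L0.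
  by apply/colP => i; rewrite f0 // mxE.
have ME : \rank (mx M dual) = \dim M.
  apply: mx_rank => [x i a f g|f fM f0].
    rewrite /dual !ffunE !mxE; case: ifP => // _; case: skew => //.
    by rewrite opprD -mulrN.
  apply/ffunP => x; rewrite ffunE; have [xU|xU] := boolP (x \in U); last exact: M0.
  have := f0 x ord0 xU; have := f0 x ord_max xU; rewrite /dual /= => h1 h2.
  apply: (@coords_eq0 _ true) => //=; move: h1.
  by case: skew => // /eqP; rewrite oppr_eq0 => /eqP.
have -> : (2 * #|U|)%N = #|D| by rewrite cardsX cardsT card_ord mulnC.
rewrite -LE -ME -[X in (_ + X <= _)%N]mxrank_tr; apply: mulmx0_rank_max.
apply/matrixP => i j; rewrite !mxE.
under eq_bigr do rewrite !mxE.
rewrite -(big_enum_val (A := mem D) (fun p : E * 'I_2 =>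
  (vbasis L)`_i p.1 p.2 ord0 * dual (vbasis M)`_j p.1 p.2)).
rewrite -[RHS](LM (vbasis L)`_i (vbasis M)`_j); last first.
- by rewrite vbasis_mem // mem_nth // size_tuple.
- by rewrite vbasis_mem // mem_nth // size_tuple.
rewrite (eq_bigl (fun p => (p.1 \in U) && (p.2 \in [set: 'I_2]))); last first.
  by move=> p; rewrite !inE.
rewrite -(pair_big (mem U) (mem [set: 'I_2])
  (fun x k => (vbasis L)`_i x k ord0 * dual (vbasis M)`_j x k)) /=.
rewrite /aform /= [RHS](bigID (mem U)) /= [X in _ = _ + X]big1 ?addr0; last first.
  by move=> x xU; rewrite L0 ?formK0l // vbasis_mem // mem_nth // size_tuple.
apply: eq_bigr => x _.
under eq_bigl do rewrite in_setT.
rewrite big_ord_recl big_ord1 /dual /= /formK /bminus /bplus.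
have -> : lift ord0 ord0 = ord_max :> 'I_2 by apply: val_inj.
by case: skew; rewrite ?mulrN.
Qed.


(** As a subspace of [L], [times L U] is orthogonal to itself. *)
Lemma times_dim_le S L U : alagrangian S L -> (\dim (times L U) <= #|U|)%N.
Proof.
case=> _ iso _; rewrite -(leq_pmul2l (isT : (0 < 2)%N)) [X in (X <= _)%N]mul2n -addnn.
by apply: dim_orthogonal => [f x /mem_times[_]|f x /mem_times[_]
  |f g /mem_times[fL _] /mem_times[gL _]];
  [exact|exact|exact: iso].
Qed.

Lemma aform_eq f f' g g' :
  (forall x, formK skew (f x) (g x) = formK skew (f' x) (g' x)) ->
  aform f g = aform f' g'.
Proof. by move=> h; apply: eq_bigr => x _. Qed.

(* The restriction of [L] to [U] is orthogonal to [times L U]. *)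
Lemma lam_complement_le S L U :
  alagrangian S L -> U \subset S -> (lam L (S :\: U) <= lam L U)%N.
Proof.
move=> lL US; have dU := times_dim_le U lL; have dC := times_dim_le (S :\: U) lL.
case: lL => sup iso dL.
have : (\dim (linfun (erase (~: U)) @: L) + \dim (times L U) <= 2 * #|U|)%N.
  apply: dim_orthogonal => [_ x /memv_imgP[f fL ->] xU|f x /mem_times[_]|]; last 2 first.
  - exact.
  - move=> _ g /memv_imgP[f fL ->] /mem_times[gL g0].
    rewrite -(iso f g fL gL); apply: aform_eq => x.
    rewrite linfunE; last exact: erase_linear.
    by rewrite ffunE inE; case: ifP => [/g0->|//]; rewrite !formK0r.
  - by rewrite linfunE ?ffunE ?inE ?xU //; exact: erase_linear.
(* The chains of [L] that restrict to 0 on [U] form [times L (S :\: U)], so the restriction has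
   dimension [#|S| - \dim (times L (S :\: U))]. *)
have := limg_ker_dim (linfun (erase (~: U))) L.
have -> : (L :&: lker (linfun (erase (~: U))))%VS = times L (S :\: U).
  apply/vspaceP => f; rewrite memv_cap memv_ker linfunE; last exact: erase_linear.
  apply/andP/idP => [[fL /eqP f0]|/mem_times[fL f0]]; last first.
    split=> //; apply/eqP/ffunP => x; rewrite !ffunE inE; case: ifPn => // xU.
    by apply: f0; rewrite !inE (negbNE xU).
  apply/mem_times; split=> // x; rewrite !inE negb_and negbK.
  case/orP => [xU|]; last exact: sup.
  by move/ffunP/(_ x): f0; rewrite !ffunE inE xU.
rewrite dL /lam cardsD (setIidPr US) in dC *.
have := subset_leq_card US; dim_lia.
Qed.

Lemma lam_complement S L U :
  alagrangian S L -> U \subset S -> lam L (S :\: U) = lam L U.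
Proof.
move=> lL US; apply/eqP; rewrite eqn_leq (lam_complement_le lL US).
have := lam_complement_le lL (subsetDl S U).
by rewrite setDDr setDv set0U (setIidPr US).
Qed.

(** Adding the values of [lam] at [U] and at its complement, which agree, shows that the factor 1/2
    in the connectivity function yields a natural number here. *)
Lemma lamE S L U : alagrangian S L -> U \subset S ->
  (\dim L = \dim (times L (S :\: U)) + \dim (times L U) + 2 * lam L U)%N.
Proof.
move=> lL US; have := lam_complement lL US.
have := times_dim_le U lL; have := times_dim_le (S :\: U) lL.
have := subset_leq_card US; case: lL => _ _ ->.
rewrite /lam cardsD (setIidPr US); dim_lia.
Qed.

(** * Composition of minors *)

Lemma minorU A T1 T2 L : [disjoint T1 & T2] ->
  minor A (T1 :|: T2) L = minor A T2 (minor A T1 L).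
Proof.
move=> dis; apply/vspaceP => g; apply/idP/idP.
  move=> /mem_minor[f [fL f0 ->]]; apply/mem_minor; exists (erase T1 f).
  split.
  - by apply/mem_minor; exists f; split=> // x xT; apply: f0; rewrite inE xT.
  - move=> x xT; rewrite ffunE; case: ifP => _; first by rewrite mxE.
    by apply: f0; rewrite inE xT orbT.
  - by apply/ffunP => x; rewrite !ffunE inE; case: (x \in T1); case: (x \in T2).
move=> /mem_minor[f [/mem_minor[h [hL h0 ->]] f0 ->]]; apply/mem_minor; exists h; split=> //.
- move=> x; rewrite inE => /orP[/h0//|xT].
  by have := f0 x xT; rewrite ffunE (disjointFl dis xT).
- by apply/ffunP => x; rewrite !ffunE inE; case: (x \in T1); case: (x \in T2).
Qed.

Lemma eq_minor A B T L : {in T, A =i B} -> minor A T L = minor B T L.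
Proof.
move=> AB; apply/vspaceP => g; apply/idP/idP => /mem_minor[f [fL f0 ->]];
  apply/mem_minor; exists f; split=> // x xT; have := f0 x xT; by rewrite AB.
Qed.

Lemma minor0 A L : minor A set0 L = L.
Proof.
have e f : erase set0 f = f by apply/ffunP => x; rewrite !ffunE inE.
apply/vspaceP => g; apply/idP/idP => [/mem_minor[f [fL f0 ->]]|gL]; rewrite ?e //.
by apply/mem_minor; exists g; split; rewrite ?e // => x; rewrite inE.
Qed.

Lemma coord_image_dim x i L :
  (\dim (linfun (fun f : achain => f x i ord0 : F^o) @: L) <= 1)%N.
Proof. by rewrite (leq_trans (dimvS (subvf _))) // dimvf. Qed.

(** * Removing one point *)

Lemma minor1_lagrangian A S L v :
  v \in S -> alagrangian S L -> alagrangian (S :\ v) (minor A [set v] L).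
Proof.
move=> vS [sup iso dL]; set b := v \in A.
have supM : forall f x, f \in minor A [set v] L -> x \notin S :\ v -> f x = 0.
  move=> _ x /mem_minor[f [fL f0 ->]]; rewrite !ffunE !inE negb_and negbK.
  by case: eqP => //= _; apply: sup.
have isoM : forall f g, f \in minor A [set v] L -> g \in minor A [set v] L ->
    aform f g = 0.
  move=> _ _ /mem_minor[f [fL f0 ->]] /mem_minor[g [gL g0 ->]].
  rewrite -(iso f g fL gL); apply: aform_eq => x; rewrite !ffunE inE.
  case: eqP => // ->; have := set11 v => vv.
  by rewrite formK0l (formK_isotropic (f0 v vv) (g0 v vv)).
split=> //; apply/eqP; rewrite eqn_leq; apply/andP; split.
  rewrite -(leq_pmul2l (isT : (0 < 2)%N)) [X in (X <= _)%N]mul2n -addnn.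
  exact: dim_orthogonal.
pose h := linfun (fun f : achain => f v (axis b) ord0 : F^o).
have -> : minor A [set v] L = (linfun (erase [set v]) @: (L :&: lker h))%VS.
  by rewrite /minor big_set1.
have hE f : h f = f v (axis b) ord0 by rewrite linfunE //; exact: coord_linear.
have := limg_ker_dim (linfun (erase [set v])) (L :&: lker h).
have := limg_ker_dim h L; have := coord_image_dim v (axis b) L.
rewrite -/h dL (cardsD1 v S) vS.
set C := (L :&: lker h :&: _)%VS.
have memC f : f \in C -> [/\ f \in L, f v (axis b) ord0 = 0 & forall x, x != v -> f x = 0].
  rewrite !memv_cap !memv_ker hE linfunE; last exact: erase_linear.
  case/andP=> [/andP[-> /eqP->] /eqP f0]; split=> // x xv.
  by move/ffunP/(_ x): f0; rewrite !ffunE inE (negbTE xv).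
(* A nonzero chain of [L] supported at [v] forces [L] into [lker h]. *)
have [->|C0] := eqVneq C 0%VS; first by rewrite dimv0; dim_lia.
have -> : (L :&: lker h)%VS = L.
  apply/capv_idPl/subvP => f fL; rewrite memv_ker hE; apply/eqP.
  have [cL cv c0] := memC _ (memv_pick C).
  apply: (formK_orthogonal cv).
    apply: contraNneq C0 => cv0; rewrite -vpick0; apply/eqP/ffunP => x.
    by rewrite [RHS]ffunE; have [->//|/c0] := eqVneq x v.
  rewrite -[RHS](iso f _ fL cL) /aform (bigD1 v) //= big1 ?addr0 // => x xv.
  by rewrite c0 ?formK0r.
(* Chains in [C] live at [v] with one coordinate zero, so the other coordinate embeds [C] into F. *)
suff : (\dim C <= 1)%N by rewrite dL (cardsD1 v S) vS; dim_lia.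
apply: leq_trans (coord_image_dim v (axis (~~ b)) C).
rewrite limg_dim_eq //; apply/eqP; rewrite -subv0; apply/subvP => f.
rewrite memv_cap memv_ker linfunE; last exact: coord_linear.
case/andP=> /memC[_ f1 f0] /eqP f2; rewrite memv0; apply/eqP/ffunP => x.
rewrite ffunE; have [->|/f0//] := eqVneq x v; exact: (coords_eq0 f1).
Qed.

(** Chains of [L] supported in [U] vanish at [v], so they survive unchanged in the minor. *)
Lemma minor1_lam_le A L v U :
  v \notin U -> (lam (minor A [set v] L) U <= lam L U)%N.
Proof.
move=> vU; rewrite /lam leq_sub2l //; apply/dimvS/subvP => f /mem_times[fL f0].
apply/mem_times; split=> //; apply/mem_minor; exists f; split=> // [x|].
  by rewrite inE => /eqP->; rewrite f0 // mxE.
by apply/ffunP => x; rewrite ffunE inE; case: eqP => // ->; rewrite f0.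
Qed.

(** The complement of [U] in [S :\ v] is that of [v |: U] in [S], so symmetry reduces this to sets
    avoiding [v]. *)
Lemma minor1_lam_leU A S L v U :
    alagrangian S L -> v \in S -> U \subset S :\ v ->
  (lam (minor A [set v] L) U <= lam L (v |: U))%N.
Proof.
move=> lL vS US; have lM := minor1_lagrangian A vS lL.
rewrite -(lam_complement lM US).
have vUS : v |: U \subset S by rewrite subUset sub1set vS (subset_trans US (subsetDl _ _)).
rewrite -(lam_complement lL vUS) setDDl.
by apply: minor1_lam_le => //; rewrite !inE eqxx.
Qed.

(** [setT] deletes [v] and [set0] contracts it. The proof lifts both families of supported chains to
    [L] and applies the dimension formula for sum and intersection. *)
Lemma lam_minor1_submodular S L v (X Y : {set E}) :
    alagrangian S L -> v \in S -> X \subset S :\ v -> Y \subset S :\ v ->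
  (lam L (X :&: Y) + lam L (v |: (X :|: Y)) <=
   lam (minor setT [set v] L) X + lam (minor set0 [set v] L) Y + 1)%N.
Proof.
move=> lL vS XS YS.
have vX : v \notin X by apply/negP => /(subsetP XS); rewrite !inE eqxx.
have vY : v \notin Y by apply/negP => /(subsetP YS); rewrite !inE eqxx.
(* Lifts of the chains counted in the minor: the value at [v] is free except for the deletion or
   contraction condition. *)
pose W A U := (times L (v |: U) :&:
   lker (linfun (fun f : achain => f v (axis (v \in A)) ord0 : F^o)))%VS.
have memW A U f : f \in W A U -> [/\ f \in L, f v (axis (v \in A)) ord0 = 0 
      & forall x, x != v -> x \notin U -> f x = 0].
  rewrite memv_cap memv_ker linfunE; last exact: coord_linear.
  case/andP=> /mem_times[-> f0] /eqP ->; split=> // x xv xU; apply: f0.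
  by rewrite !inE negb_or xv.
have dimW A U : v \notin U -> (\dim (times (minor A [set v] L) U) <= \dim (W A U))%N.
  move=> vU; suff sub : (times (minor A [set v] L) U <= linfun (erase [set v]) @: W A U)%VS.
    by rewrite (leq_trans (dimvS sub)) //
      -(limg_ker_dim (linfun (erase [set v])) (W A U)) leq_addl.
  apply/subvP => _ /mem_times[/mem_minor[f [fL f0 ->]] g0].
  apply/memv_imgP; exists f; last by rewrite linfunE //; exact: erase_linear.
  rewrite memv_cap memv_ker linfunE; last exact: coord_linear.
  rewrite f0 ?inE // eqxx andbT; apply/mem_times; split=> // x.
  by rewrite !inE negb_or => /andP[xv /g0]; rewrite ffunE inE (negbTE xv).
have sumW : (\dim (W setT X + W set0 Y)%VS <= \dim (times L (v |: (X :|: Y))))%N.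
  apply/dimvS/subvP => _ /memv_addP[f /memW[fL _ f0] [g /memW[gL _ g0] ->]].
  apply/mem_times; split; first exact: memvD.
  move=> x; rewrite !inE !negb_or => /and3P[xv xX xY].
  by rewrite ffunE f0 // g0 // addr0.
have capW : (\dim (W setT X :&: W set0 Y)%VS <= \dim (times L (X :&: Y)))%N.
  apply/dimvS/subvP => f; rewrite memv_cap => /andP[/memW[fL f1 fX] /memW[_ f2 fY]].
  (* Deletion kills one coordinate at [v] and contraction the other. *)
  have fv : f v = 0 by apply: (@coords_eq0 _ true); rewrite ?inE in f1 f2.
  apply/mem_times; split=> // x; have [->//|xv] := eqVneq x v.
  by rewrite inE negb_and => /orP[/fX|/fY]; apply.
have := dimv_sum_cap (W setT X) (W set0 Y).
have := dimW setT X vX; have := dimW set0 Y vY.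
have lM A := minor1_lagrangian A vS lL.
have := times_dim_le X (lM setT); have := times_dim_le Y (lM set0).
have := times_dim_le (X :&: Y) lL; have := times_dim_le (v |: (X :|: Y)) lL.
(* The point [v] in the union accounts for the extra 1. *)
have := cardsUI X Y; rewrite /lam cardsU1 !inE negb_or vX vY /=; dim_lia.
Qed.

(** * Removing a set of points *)

Lemma minor_lagrangian A S T L :
  T \subset S -> alagrangian S L -> alagrangian (S :\: T) (minor A T L).
Proof.
elim: {T}_.+1 {-2}T (ltnSn #|T|) S L => // n IH T Tn S L TS lL.
have [->|[v vT]] := set_0Vmem T; first by rewrite minor0 setD0.
rewrite -(setD1K vT) minorU; last by rewrite disjoints1 !inE eqxx.
have vS := subsetP TS v vT; rewrite -setDDl; apply: IH.
- by rewrite (cardsD1 v) vT in Tn.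
- exact: setSD.
- exact: minor1_lagrangian.
Qed.

(** This is the direction from minors to separating sets. Points of [T] are removed one by one, and
    each is dropped from [Z] if it lies there. *)
Lemma minor_lam_le A S T L (X Z : {set E}) :
    T \subset S -> alagrangian S L -> X \subset S :\: T ->
    X \subset Z -> Z \subset X :|: T ->
  (lam (minor A T L) X <= lam L Z)%N.
Proof.
elim: {T}_.+1 {-2}T (ltnSn #|T|) S L Z => // n IH T Tn S L Z TS lL XST XZ ZXT.
have [T0|[v vT]] := set_0Vmem T.
  have -> : Z = X by apply/eqP; rewrite eqEsubset XZ andbT -[X]setU0 -T0.
  by rewrite T0 minor0.
have vS := subsetP TS v vT.
have vX : v \notin X by apply/negP => /(subsetP XST); rewrite inE vT.
rewrite -(setD1K vT) minorU; last by rewrite disjoints1 !inE eqxx.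
apply: (@leq_trans (lam (minor A [set v] L) (Z :\ v))).
  apply: (IH _ _ (S :\ v)).
  - by rewrite (cardsD1 v) vT in Tn.
  - exact: setSD.
  - exact: minor1_lagrangian.
  - by rewrite setDDl setD1K.
  - by rewrite subsetD1 XZ.
  - by rewrite subDset setUCA setD1K.
have ZS : Z \subset S.
  apply: (subset_trans ZXT); rewrite subUset TS andbT.
  exact: (subset_trans XST (subsetDl _ _)).
have [vZ|vZ] := boolP (v \in Z).
  rewrite -{2}(setD1K vZ); apply: (minor1_lam_leU A lL vS); exact: setSD.
have -> : Z :\ v = Z by apply/setDidPl; rewrite disjoint_sym disjoints1.
exact: minor1_lam_le.
Qed.

(** The converse direction: at each point of [T], deletion or contraction preserves the bound for
    all separating sets. *)
Lemma exists_linked_minor S T L (X : {set E}) k :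
    T \subset S -> alagrangian S L -> X \subset S :\: T ->
    (forall Z, X \subset Z -> Z \subset X :|: T -> k <= lam L Z)%N ->
  exists2 A : {set E}, A \subset T & (k <= lam (minor A T L) X)%N.
Proof.
elim: {T}_.+1 {-2}T (ltnSn #|T|) S L => // n IH T Tn S L TS lL XST kZ.
have [->|[v vT]] := set_0Vmem T.
  by exists set0; rewrite ?sub0set // minor0 kZ // subsetUl.
have vS := subsetP TS v vT.
have vX : v \notin X by apply/negP => /(subsetP XST); rewrite inE vT.
have XS : X \subset S := subset_trans XST (subsetDl _ _).
have minE A : minor A T L = minor A (T :\ v) (minor A [set v] L).
  by rewrite -{1}(setD1K vT) minorU // disjoints1 !inE eqxx.
(* Once the choice [B] at [v] keeps the bound, induction handles [T :\ v]; the resulting set gains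
   [v] exactly when [v] was deleted. *)
have step B : (forall Z, X \subset Z -> Z \subset X :|: (T :\ v) ->
       k <= lam (minor B [set v] L) Z)%N ->
     exists2 A : {set E}, A \subset T & (k <= lam (minor A T L) X)%N.
  move=> kB; case: (IH (T :\ v) _ (S :\ v) (minor B [set v] L)) => //.
  - by rewrite (cardsD1 v) vT in Tn.
  - exact: setSD.
  - exact: minor1_lagrangian.
  - by rewrite setDDl setD1K.
  move=> A AT kA; exists (if v \in B then v |: A else A).
    have AT' := subset_trans AT (subsetDl _ _).
    by case: ifP => // _; rewrite subUset sub1set vT.
  have vA : v \notin A by apply/negP => /(subsetP AT); rewrite !inE eqxx.
  rewrite minE (@eq_minor _ A (T :\ v)); last first.
    by move=> x; rewrite !inE => /andP[xv _]; case: ifP => _; rewrite ?inE ?(negbTE xv).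
  rewrite (@eq_minor _ B [set v]) // => x; rewrite inE => /eqP->.
  by case: ifP => _; rewrite ?inE ?eqxx // (negbTE vA).
case: (boolP [forall Z : {set E}, (X \subset Z) ==> (Z \subset X :|: (T :\ v)) ==>
       (k <= lam (minor setT [set v] L) Z)%N]) => [/forallP h1|].
  by apply: (step setT) => Z XZ ZT; have := h1 Z; rewrite XZ ZT.
rewrite negb_forall => /existsP[Z1]; rewrite !negb_imply -ltnNge => /and3P[XZ1 Z1T k1].
(* Deletion fails at [Z1]. If contraction failed at [Z2], submodularity would give
   [2k <= (k - 1) + (k - 1) + 1], since [Z1 :&: Z2] and [v |: (Z1 :|: Z2)] are both admissible for
   [L]. *)
apply: (step set0) => Z2 XZ2 Z2T; rewrite leqNgt; apply/negP => k2.
have XTS : X :|: (T :\ v) \subset S :\ v.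
  by rewrite subUset setSD // andbT subsetD1 XS.
have := lam_minor1_submodular lL vS (subset_trans Z1T XTS) (subset_trans Z2T XTS).
have XTT : X :|: (T :\ v) \subset X :|: T by rewrite setUS // subsetDl.
have : (k <= lam L (Z1 :&: Z2))%N.
  apply: kZ; first by rewrite subsetI XZ1.
  by apply: subset_trans XTT; rewrite subIset // Z1T.
have : (k <= lam L (v |: (Z1 :|: Z2)))%N.
  apply: kZ; first by rewrite setUCA subsetU // XZ1.
  by rewrite subUset sub1set inE vT orbT subUset !(subset_trans _ XTT).
dim_lia.
Qed.


(** * Transfer from chains on [S] to ambient chains *)

Definition extend S (f : chain F S) : achain :=
  [ffun x => if insub x is Some y then f y else 0].

Definition extend_group S (M : chain_group F S) : {vspace achain} :=
  (linfun (@extend S) @: M)%VS.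

Lemma extend_val S (f : chain F S) (y : {x : E | x \in S}) : extend f (val y) = f y.
Proof. by rewrite ffunE valK. Qed.

Lemma extend_out S (f : chain F S) x : x \notin S -> extend f x = 0.
Proof. by move=> xS; rewrite ffunE insubN. Qed.

Lemma extend_linear S : linear (@extend S).
Proof.
move=> a f g; apply/ffunP => x; rewrite !ffunE.
by case: insub => [y|]; rewrite ?ffunE // scaler0 addr0.
Qed.

Lemma extend_restrict S T (f : chain F S) :
  extend (restrict T f) = erase (~: T) (extend f).
Proof.
apply/ffunP => x; rewrite [RHS]ffunE inE; case: (boolP (x \in T)) => /= xT;
  last exact: extend_out.
by rewrite -[x]/(val (exist (fun x => x \in T) x xT)) extend_val !ffunE.
Qed.

Lemma mem_extend_group S (M : chain_group F S) g :
  g \in extend_group M <-> exists2 f, f \in M & g = extend f.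
Proof.
split=> [/memv_imgP[f fM ->]|[f fM ->]].
  by exists f; rewrite // linfunE //; exact: extend_linear.
by apply/memv_imgP; exists f; rewrite // linfunE //; exact: extend_linear.
Qed.

Lemma dim_extend_group S (M : chain_group F S) : \dim (extend_group M) = \dim M.
Proof.
apply/limg_dim_eq/eqP; rewrite -subv0; apply/subvP => f.
rewrite memv_cap memv_ker linfunE; last exact: extend_linear.
case/andP=> _ /eqP f0; rewrite memv0; apply/eqP/ffunP => y.
by rewrite -extend_val f0 !ffunE.
Qed.

Lemma extend_group_times S (M : chain_group F S) T :
  extend_group (cg_times M T) = times (extend_group M) T.
Proof.
have e (f : chain F S) : (forall x, x \notin T -> extend f x = 0) ->
    extend (restrict T f) = extend f.
  move=> f0; rewrite extend_restrict; apply/ffunP => x; rewrite [LHS]ffunE inE.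
  by case: ifP => // /f0.
apply/vspaceP => g; apply/idP/idP.
  move=> /mem_extend_group[_ /mem_cg_times[f [fM f0 ->]] ->].
  have f0' x : x \notin T -> extend f x = 0.
    by move=> xT; rewrite ffunE; case: insubP => // y _ yx; rewrite f0 // yx.
  apply/mem_times; rewrite e //; split=> //.
  by apply/mem_extend_group; exists f.
move=> /mem_times[/mem_extend_group[f fM ->] f0].
apply/mem_extend_group; exists (restrict T f); last by rewrite e.
by apply/mem_cg_times; exists f; split=> // y yT; rewrite -extend_val f0.
Qed.

Lemma extend_group_minor_by (b : bool) A S (M : chain_group F S) T :
    {in T, forall x, (x \in A) = b} ->
  extend_group (cg_minor_by skew (if b then vec2 1 0 else vec2 0 1) M T)
  = minor A T (extend_group M).
Proof.
move=> Ab.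
have e (f : chain F S) : extend (restrict (S :\: T) f) = erase T (extend f).
  rewrite extend_restrict; apply/ffunP => x;
  rewrite [LHS]ffunE [RHS]ffunE !inE negb_and negbK.
  by case: (x \in T) => //=; case: ifP => // xS; rewrite extend_out ?xS.
apply/vspaceP => g; apply/idP/idP.
  move=> /mem_extend_group[_ /mem_cg_minor_by[f [fM f0 ->]] ->].
  apply/mem_minor; exists (extend f); rewrite e; split=> //.
    by apply/mem_extend_group; exists f.
  move=> x xT; rewrite Ab // ffunE; case: insubP => [y _ yx|_]; last by rewrite mxE.
  by apply/eqP; rewrite -formK_axis f0 // yx.
move=> /mem_minor[_ [/mem_extend_group[f fM ->] f0 ->]]; rewrite -e.
apply/mem_extend_group; exists (restrict (S :\: T) f) => //.
apply/mem_cg_minor_by; exists f; split=> // y yT.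
by apply/eqP; rewrite formK_axis -extend_val -(Ab _ yT) f0.
Qed.

(** This order of operations occurs in the min-max formula, the opposite one in [is_minor]; both
    give the same ambient minor. *)
Lemma extend_group_delete_contract S (M : chain_group F S) A B :
    [disjoint A & B] ->
  extend_group (cg_contract skew (cg_delete skew M A) B)
  = minor A (A :|: B) (extend_group M).
Proof.
move=> dis; rewrite (extend_group_minor_by (b := false) (A := A)); last first.
  by move=> x xB; rewrite (disjointFl dis).
by rewrite (extend_group_minor_by (b := true) (A := A)) // -minorU.
Qed.

Lemma extend_group_contract_delete S (M : chain_group F S) A B :
    [disjoint A & B] ->
  extend_group (cg_delete skew (cg_contract skew M B) A)
  = minor A (A :|: B) (extend_group M).
Proof.
move=> dis; rewrite (extend_group_minor_by (b := true) (A := A)) //.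
rewrite (extend_group_minor_by (b := false) (A := A)); last first.
  by move=> x xB; rewrite (disjointFl dis).
by rewrite -minorU 1?setUC // disjoint_sym.
Qed.

Lemma lagrangian_extend_group S (M : chain_group F S) :
  lagrangian skew M -> alagrangian S (extend_group M).
Proof.
case=> iso dM; split; last by rewrite dim_extend_group.
  by move=> _ x /mem_extend_group[f _ ->]; exact: extend_out.
move=> _ _ /mem_extend_group[f fM ->] /mem_extend_group[g gM ->].
rewrite -(iso f g fM gM) /aform /form_chain (bigID (mem S)) /= [X in _ + X]big1 ?addr0.
  by rewrite big_sub; apply: eq_bigr => y _; rewrite !extend_val.
by move=> x xS; rewrite extend_out // formK0l.
Qed.

Lemma connectivity_lam S (M : chain_group F S) U :
    alagrangian S (extend_group M) -> U \subset S ->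
  connectivity M U = (lam (extend_group M) U)%:R.
Proof.
move=> lM US; have := lamE lM US; rewrite -!extend_group_times !dim_extend_group.
rewrite /connectivity => ->; move: (\dim _) (\dim _) (lam _ _) => b a c.
rewrite (natrD _ (a + b)%N) (natrD _ a) natrM.
apply: (canLR (mulfK _)); rewrite ?pnatr_eq0 //.
by rewrite mulrC -addrA -opprD [a%:R + b%:R + _]addrC addrK.
Qed.

Lemma is_minor_extend S S' (M : chain_group F S) (M' : chain_group F S') :
    is_minor skew M M' ->
  exists A B, [/\ A \subset S, B \subset S, [disjoint A & B],
                  S' = S :\: (A :|: B)
                & extend_group M' = minor A (A :|: B) (extend_group M)].
Proof.
case=> X' Y' XS YS dis; exists Y', X'; split=> //.
- by rewrite disjoint_sym.
- by rewrite setDDl setUC.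
- by rewrite extend_group_contract_delete // disjoint_sym.
Qed.

(** The ground set is a variable [S'] with an equation, so that chain-groups on [X :|: Y] need no
    cast. *)
Lemma exists_is_minor S S' (M : chain_group F S) A B :
    A \subset S -> B \subset S -> [disjoint A & B] -> S' = S :\: (A :|: B) ->
  exists2 M' : chain_group F S', is_minor skew M M'
    & extend_group M' = minor A (A :|: B) (extend_group M).
Proof.
move=> AS BS dis; rewrite setUC -setDDl => ->.
exists (cg_delete skew (cg_contract skew M B) A).
  by apply: IsMinor => //; rewrite disjoint_sym.
by rewrite extend_group_contract_delete // setUC.
Qed.

End Ambient.

(** * The equivalence and the min-max equality for [N] *)

Theorem theorem5p3 (F : fieldType) (skew : bool) (E : finType)
    (V X Y : {set E}) (hXV : X \subset V) (hYV : Y \subset V)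
    (hXY : [disjoint X & Y]) (N : chain_group F V)
    (hN : lagrangian skew N) :
  (forall k : rat,
     (forall Z : {set E}, X \subset Z -> Z \subset V :\: Y ->
        k <= connectivity N Z)
     <->
     (exists M : chain_group F (X :|: Y),
        is_minor skew N M /\ k <= connectivity M X))
  /\
  \big[Order.min/connectivity N X]_(Z : {set E} |
      (X \subset Z) && (Z \subset V :\: Y)) connectivity N Z
  = \big[Order.max/connectivity
         (cg_contract skew (cg_delete skew N (V :\: (X :|: Y))) set0) X]_(
      p : {set E} * {set E} |
        (p.1 :|: p.2 == V :\: (X :|: Y)) && (p.1 :&: p.2 == set0))
      connectivity (cg_contract skew (cg_delete skew N p.1) p.2) X.
Proof.
set L := extend_group N; set T := V :\: (X :|: Y).
have lL : alagrangian skew V L := lagrangian_extend_group hN.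
have TV : T \subset V := subsetDl _ _.
have XYV : X :|: Y \subset V by rewrite subUset hXV.
have VT : V :\: T = X :|: Y by rewrite setDDr setDv set0U; apply/setIidPr.
have XT : X \subset V :\: T by rewrite VT subsetUl.
have VY : V :\: Y = X :|: T.
  apply/setP => x; rewrite !inE; have := subsetP hXV x.
  case: (boolP (x \in X)) => [xX /(_ isT)->|_ _] /=; last by [].
  by rewrite (disjointFr hXY xX).
have connN (Z : {set E}) : Z \subset V :\: Y -> connectivity N Z = (lam L Z)%:R.
  by move=> ZV; apply: (connectivity_lam lL); exact: (subset_trans ZV (subsetDl _ _)).
have connM (A S : {set E}) (M : chain_group F S) : S = X :|: Y ->
    extend_group M = minor A T L ->
    connectivity M X = (lam (minor A T L) X)%:R.
  move=> eS eM; rewrite -eM; apply: (@connectivity_lam _ _ skew); last by rewrite eS subsetUl.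
  by rewrite eM eS -VT; apply: minor_lagrangian.
have minor_le (A Z : {set E}) : X \subset Z -> Z \subset V :\: Y ->
    (lam (minor A T L) X <= lam L Z)%N.
  by rewrite VY => XZ ZT; apply: (minor_lam_le A TV lL XT).
have XVY : X \subset V :\: Y by rewrite VY subsetUl.
pose P (Z : {set E}) := (X \subset Z) && (Z \subset V :\: Y).
(* A minimizer [Z0] of [lam L], with its minimum as the bound, yields one minor that serves every
   [k] and the min-max equality. *)
have [Z0 [XZ0 Z0V] [A AT kA]] : exists2 Z0 : {set E}, X \subset Z0 /\ Z0 \subset V :\: Y
    & exists2 A : {set E}, A \subset T & (lam L Z0 <= lam (minor A T L) X)%N.
  have PX : P X by rewrite /P subxx.
  case: (arg_minnP (lam L) PX) => Z0 /andP[XZ0 Z0V] minZ0; exists Z0 => //.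
  apply: (exists_linked_minor TV lL XT) => Z XZ ZT.
  by apply: minZ0; rewrite /P XZ VY.
have ABT : A :|: (T :\: A) = T.
  by apply/setP => x; rewrite !inE; have := subsetP AT x;
    rewrite !inE; case: (x \in A) => // /(_ isT)->.
have disAB : [disjoint A & T :\: A].
  by rewrite disjoints_subset; apply/subsetP => x; rewrite !inE => ->.
have connp (p : {set E} * {set E}) : p.1 :|: p.2 = T -> [disjoint p.1 & p.2] ->
    connectivity (cg_contract skew (cg_delete skew N p.1) p.2) X = (lam (minor p.1 T L) X)%:R.
  by move=> pT dis; apply: connM; rewrite ?setDDl ?pT ?VT //
    extend_group_delete_contract // pT.
split=> [k|].
  split=> [kZ|[M [/(@is_minor_extend F E skew)[A1 [B1 [A1V B1V dis eS eM]]] kM]] Z XZ ZV].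
    have [||||M' minM eM] := @exists_is_minor F E skew V (X :|: Y) N A (T :\: A).
    - exact: subset_trans AT TV.
    - exact: subset_trans (subsetDl _ _) TV.
    - exact: disAB.
    - by rewrite ABT VT.
    exists M'; split=> //; rewrite ABT in eM.
    rewrite (connM A) //; apply: le_trans (kZ Z0 XZ0 Z0V) _.
    by rewrite connN // ler_nat.
  (* The ground set of the minor determines which points were removed. *)
  have ABT1 : A1 :|: B1 = T.
    by rewrite /T eS setDDr setDv set0U; apply/esym/setIidPr; rewrite subUset A1V.
  apply: le_trans kM _; rewrite ABT1 in eM.
  by rewrite (connM A1) // connN // ler_nat minor_le.
apply/eqP; rewrite eq_le; apply/andP; split.
  apply: (bigmin_inf Z0); first by rewrite XZ0.
  apply: (bigmax_sup (A, T :\: A)); first by rewrite /= ABT eqxx setI_eq0.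
  by rewrite connp //= connN // ler_nat.
have bound (p : {set E} * {set E}) : p.1 :|: p.2 = T -> [disjoint p.1 & p.2] ->
    connectivity (cg_contract skew (cg_delete skew N p.1) p.2) X <=
    \big[Order.min/connectivity N X]_(Z : {set E} | P Z) connectivity N Z.
  (* The default of the minimum is the value at the admissible set [X]. *)
  move=> pT dis; rewrite connp //; apply: le_bigmin => [|Z /andP[XZ ZV]].
    by rewrite connN // ler_nat minor_le.
  by rewrite connN // ler_nat minor_le.
apply: bigmax_le => [|p /andP[/eqP pT p0]].
  (* The default of the maximum is the minor that deletes all of [T]. *)
  by apply: (bound (T, set0)); rewrite /= ?setU0 // -setI_eq0 setI0.
by apply: bound => //; rewrite -setI_eq0.
Qed.
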